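(* Let $0<\beta<1$, $0\le\alpha\le 1$, let $T\ge 2$ be an integer, let $\kappa=(1-\beta)(1-\alpha\beta)(1-\alpha^2\beta)$, and let $K_{DC2}$ be the $T\times T$ DC2 kernel matrix with hyperparameters $\alpha,\beta$. Then the inverse of $K_{DC2}$ admits the decomposition $$K_{DC2}^{-1}=\kappa^{-1}F_{2,\alpha,T}\,D_T\,F_{2,\alpha,T}^\top,$$ where $F_{2,\alpha,T}=(1-\alpha)F_T+\alpha F_T^2$, $F_T\in\mathbb{R}^{T\times T}$ is the lower triangular Toeplitz matrix with first column $(1,-1,0,\ldots,0)^\top$, and $$D_T=\begin{bmatrix} D_{1,T} & 0\\ 0& B_T\end{bmatrix},\qquad D_{1,T}=\mathrm{diag}(\beta^{-1},\beta^{-2},\ldots,\beta^{-(T-2)}),$$ $$B_T=(1-\alpha\beta)\beta^{-T}\begin{bmatrix}\beta(1+\alpha\beta) & \alpha\beta^2(1+\alpha)\\ \alpha\beta^2(1+\alpha) & (1-\beta-\alpha^2\beta)(1-\alpha\beta)+2\alpha^2\beta^2\end{bmatrix}$$ (for $T=2$ the block $D_{1,T}$ is empty). Thus $K_{DC2}^{-1}$ is a pentadiagonal matrix, i.e. $[K_{DC2}^{-1}]_{t,s}=0$ whenever $|t-s|>2$.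
   Context: Let $0<\beta<1$ and $0\le\alpha\le1$. Let $\mathcal{F}$ be the infinite (indexed by $t,s\ge 1$) lower triangular Toeplitz matrix with first column $(1,-1,0,0,\ldots)^\top$, $\mathcal{D}=\mathrm{diag}(\beta^{-1},\beta^{-2},\ldots,\beta^{-t},\ldots)$, and $\mathcal{F}_{2,\alpha}=(1-\alpha)\mathcal{F}+\alpha\mathcal{F}^2$. The (infinite) DC2 kernel is $\mathcal{K}_{DC2}=\kappa(\mathcal{F}_{2,\alpha}\mathcal{D}\mathcal{F}_{2,\alpha}^\top)^{-1}$ with $\kappa=(1-\beta)(1-\alpha\beta)(1-\alpha^2\beta)$, where the inverse is understood as $(\mathcal{F}_{2,\alpha}^{-1})^\top\mathcal{D}^{-1}\mathcal{F}_{2,\alpha}^{-1}$, with $\mathcal{F}_{2,\alpha}^{-1}$ the lower triangular Toeplitz inverse of $\mathcal{F}_{2,\alpha}$, and entries of products of infinite matrices are (convergent) series. The $T\times T$ kernel matrix $K_{DC2}$ is defined by $[K_{DC2}]_{t,s}=[\mathcal{K}_{DC2}]_{t,s}$ for $t,s=1,\ldots,T$. *)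

(* Defs.v *)
From HB Require Import structures.
From mathcomp Require Import all_boot all_order all_algebra.
From mathcomp Require Import boolp classical_sets reals topology normedtype.
From mathcomp Require Import sequences.

Set Implicit Arguments.
Unset Strict Implicit.
Unset Printing Implicit Defensive.

Import Order.TTheory GRing.Theory Num.Theory.
Import numFieldNormedType.Exports.

Local Open Scope ring_scope.
Local Open Scope classical_set_scope.

(* Infinite matrices indexed by t, s >= 1. Indices are shifted to start at 0,
   as for 'M_T: the mathematical entry (t, s) is [A t.-1 s.-1]. *)
Definition infmx (R : Type) : Type := nat -> nat -> R.

Section InfiniteMatrices.
Variable R : realType.
Implicit Types (A B : infmx R) (c d : nat -> R).

Definition infmx1 : infmx R := fun i j => (i == j)%:R.

Definition inf_tr A : infmx R := fun i j => A j i.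

Definition inf_diag d : infmx R := fun i j => if i == j then d i else 0.

(* Each entry is the sum of a series; [limn] is 0 on a divergent sequence. *)
Definition inf_mul A B : infmx R :=
  fun i j => limn (series (fun k => A i k * B k j)).

Definition ltoeplitz c : infmx R :=
  fun i j => if (j <= i)%N then c (i - j)%N else 0.

Definition is_ltoeplitz_inverse A : set (infmx R) :=
  [set G | (exists c, G = ltoeplitz c) /\
           inf_mul A G = infmx1 /\ inf_mul G A = infmx1].

(* The lower triangular Toeplitz inverse of A (the zero matrix when A has
   none). *)
Definition ltoeplitz_inv A : infmx R :=
  xget (fun _ _ => 0) (is_ltoeplitz_inverse A).

End InfiniteMatrices.

Section DC2.
Variables (R : realType) (alpha beta : R).

Definition first_col : nat -> R := fun k => [:: 1; -1]`_k.

Definition infF : infmx R := ltoeplitz first_col.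

Definition infF2 : infmx R :=
  fun i j => (1 - alpha) * infF i j + alpha * inf_mul infF infF i j.

(* Diagonal of the infinite matrix D: position i (from 0) holds
   beta^-(i+1). *)
Definition diagD : nat -> R := fun i => beta ^- i.+1.

Definition kappa : R :=
  (1 - beta) * (1 - alpha * beta) * (1 - alpha ^+ 2 * beta).

(* kappa (F2 D F2^T)^-1, read as kappa (F2^-1)^T D^-1 F2^-1. *)
Definition infK_DC2 : infmx R :=
  let G := ltoeplitz_inv infF2 in
  let Dinv := inf_diag (fun i => (diagD i)^-1) in
  fun i j => kappa * inf_mul (inf_mul (inf_tr G) Dinv) G i j.

Definition K_DC2 (T : nat) : 'M[R]_T := \matrix_(i, j) infK_DC2 i j.

Definition F_ (T : nat) : 'M[R]_T := \matrix_(i, j) ltoeplitz first_col i j.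

Definition F2_ (T : nat) : 'M[R]_T :=
  (1 - alpha) *: F_ T + alpha *: (F_ T *m F_ T).

Definition D1_ (T : nat) : 'M[R]_(T - 2) := diag_mx (\row_i beta ^- i.+1).

Definition B_ (T : nat) : 'M[R]_2 :=
  ((1 - alpha * beta) * beta ^- T) *:
  \matrix_(i, j)
    (nth [::]
       [:: [:: beta * (1 + alpha * beta); alpha * beta ^+ 2 * (1 + alpha)];
           [:: alpha * beta ^+ 2 * (1 + alpha);
               (1 - beta - alpha ^+ 2 * beta) * (1 - alpha * beta)
               + 2 * alpha ^+ 2 * beta ^+ 2]]
       i)`_j.

Definition D_ (T : nat) (hT : (2 <= T)%N) : 'M[R]_T :=
  castmx (subnK hT, subnK hT) (block_mx (D1_ T) 0 0 (B_ T)).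

End DC2.

Definition pentadiagonal (R : realType) (T : nat) (A : 'M[R]_T) : Prop :=
  forall t s : 'I_T, (2 < `|t - s|)%N -> A t s = 0.

(* Main.v *)
Require Import Defs.
From mathcomp Require Import all_boot all_order all_algebra reals.
From mathcomp Require Import boolp classical_sets topology normedtype sequences.
From mathcomp Require Import ring lra zify.

Import Order.TTheory GRing.Theory Num.Theory.
Import numFieldNormedType.Exports.
Local Open Scope classical_set_scope.
Local Open Scope ring_scope.

(** Write [geom n] for [1 + alpha + ... + alpha^(n-1)]. Since the symbol of [F2]
    is [(1 - z)(1 - alpha z)], its Toeplitz inverse has entries
    [geom (i + 1 - j)], and the series defining the kernel telescopes, giving
    [K i (i + d) = beta^(i + d + 1) phi d] with
    [phi d = (1 - alpha^2 beta) geom d + (1 + alpha beta) alpha^d].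
    As [F2] has bandwidth 2, truncation only affects the last two columns of
    [K F2]. Hence [F2^T K F2] agrees with [kappa D^-1] outside the lower right
    2 x 2 corner, where it is computed from [phi 0] and [phi 1] and found to be
    [kappa B^-1]. *)

Section Entries.
Context {R : realType}.
Implicit Types (x : nat -> R) (A B : infmx R).

(** * Finite sums against a band, and the entries of [F] and [F2] *)

Lemma sum_delta N m x :
  \sum_(k < N) (k == m :> nat)%:R * x k = (m < N)%:R * x m.
Proof.
case: (ltnP m N) => [mN|Nm].
  rewrite (bigD1 (Ordinal mN)) //= eqxx big1 ?addr0 // => k.
  by rewrite -val_eqE /= => /negbTE ->; rewrite mul0r.
rewrite mul0r big1 // => k _.
by rewrite ltn_eqF ?mul0r // (leq_trans (ltn_ord k)).
Qed.

Lemma sum_delta_shift N i m x : (i < N)%N ->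
  \sum_(k < N) (i == m + k)%N%:R * x k = (m <= i)%:R * x (i - m)%N.
Proof.
move=> iN.
have im k : (i == m + k)%N%:R = (m <= i)%:R * (k == i - m)%N%:R :> R.
  by rewrite -natrM mulnb; congr _%:R; lia.
under eq_bigr do rewrite im -mulrA.
by rewrite -mulr_sumr sum_delta (leq_ltn_trans (leq_subr _ _) iN) mul1r.
Qed.

(** The partial sums are constant from [N] on. This removes the limit from every product except the
    kernel series itself. *)
Lemma inf_mul_finite A B (i j N : nat) :
  (forall k, (N <= k)%N -> A i k * B k j = 0) ->
  inf_mul A B i j = \sum_(k < N) A i k * B k j.
Proof.
move=> AB0; apply: cvg_lim; first exact: Rhausdorff.
apply: cvg_near_cst; exists N => // n /= Nn.
rewrite /series/= (big_cat_nat (leq0n N) Nn)/= big_mkord.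
rewrite [X in _ + X]big_nat_cond [X in _ + X]big1 ?addr0 // => k.
by case/andP => /andP[/AB0].
Qed.

Lemma infFE (i j : nat) : infF R i j = (i == j)%:R - (i == j.+1)%:R.
Proof.
rewrite /infF /ltoeplitz /first_col.
case: leqP => [ji|ij]; last first.
  by rewrite !ltn_eqF ?subr0 // ltnS ltnW.
have -> : (i == j) = (i - j == 0)%N by lia.
have -> : (i == j.+1) = (i - j == 1)%N by lia.
by case: (i - j)%N => [|[|n]] /=; rewrite ?subr0 ?sub0r ?nth_nil.
Qed.

Lemma sum_infF (i N : nat) x : (i < N)%N ->
  \sum_(k < N) infF R i k * x k = x i - (0 < i)%:R * x i.-1.
Proof.
move=> iN; under eq_bigr do rewrite infFE mulrBl.
rewrite sumrB (sum_delta_shift _ _ 0) // (sum_delta_shift _ _ 1) //.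
by rewrite subn0 subn1 mul1r.
Qed.

Variable alpha : R.

Lemma infF2E (i j : nat) : infF2 alpha i j =
  (i == j)%:R - (1 + alpha) * (i == j.+1)%:R + alpha * (i == j.+2)%:R.
Proof.
rewrite /infF2 (@inf_mul_finite _ _ _ _ i.+1); last first.
  by move=> k ik; rewrite infFE !ltn_eqF ?subrr ?mul0r // ltnW.
rewrite (sum_infF _ _ (fun k => infF R k j)) // !infFE.
case: i => [|i] /=; first by rewrite mul0r; ring.
by rewrite !eqSS mul1r; ring.
Qed.

(** A row [i < T] of the lower triangular [F] is supported on columns below [T], so truncation
    commutes with squaring. *)
Lemma F2_E T (i j : 'I_T) : F2_ alpha T i j = infF2 alpha i j.
Proof.
rewrite !mxE /infF2 (@inf_mul_finite _ _ _ _ T); last first.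
  move=> k Tk; have ik : (i < k)%N by rewrite (leq_trans (ltn_ord i)).
  by rewrite infFE !ltn_eqF ?subrr ?mul0r // ltnW.
by under eq_bigr do rewrite !mxE.
Qed.

(** The boolean factors record which of the three band entries of column [j] survive truncation at
    [N]; the corner corrections come from here. *)
Lemma sum_infF2_col (j N : nat) x :
  \sum_(k < N) infF2 alpha k j * x k =
    (j < N)%:R * x j - (1 + alpha) * (j.+1 < N)%:R * x j.+1
    + alpha * (j.+2 < N)%:R * x j.+2.
Proof.
under eq_bigr do rewrite infF2E mulrDl mulrBl -!mulrA.
by rewrite big_split sumrB/= -!mulr_sumr !sum_delta !mulrA.
Qed.

Lemma sum_infF2_row (i N : nat) x : (i < N)%N ->
  \sum_(k < N) infF2 alpha i k * x k =
    x i - (1 + alpha) * (0 < i)%:R * x i.-1 + alpha * (1 < i)%:R * x i.-2.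
Proof.
move=> iN; under eq_bigr do rewrite infF2E mulrDl mulrBl -!mulrA.
rewrite big_split sumrB/= -!mulr_sumr (sum_delta_shift _ _ 0) //.
rewrite (sum_delta_shift _ _ 1) // (sum_delta_shift _ _ 2) //.
by rewrite subn0 subn1 subn2 mul1r !mulrA.
Qed.

(** * Geometric sums and the Toeplitz inverse of [F2] *)

Definition geom n : R := \sum_(k < n) alpha ^+ k.

Lemma geom0 : geom 0 = 0. Proof. exact: big_ord0. Qed.

Lemma geomS n : geom n.+1 = 1 + alpha * geom n.
Proof.
rewrite /geom big_ord_recl expr0 mulr_sumr; congr (_ + _).
by apply: eq_bigr => i _; rewrite -exprS.
Qed.

(** Relates powers to [geom] without dividing by [1 - alpha], so that [alpha = 1] is covered by the
    same identities. *)
Lemma geom_exp n : alpha ^+ n = 1 - (1 - alpha) * geom n.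
Proof.
elim: n => [|n IH]; first by rewrite geom0 mulr0 subr0.
by rewrite exprS IH geomS; ring.
Qed.

Lemma geomD m n : geom (m + n) = geom m + alpha ^+ m * geom n.
Proof.
elim: m => [|m IH]; first by rewrite geom0 add0r mul1r.
by rewrite addSn !geomS IH exprS; ring.
Qed.

(** The coefficients are those of [(1 - z)(1 - alpha z)], whose inverse series has coefficients
    [geom n.+1]. For [n <= 1] the saturating predecessors land on [geom 0 = 0]. *)
Lemma geom_rec n :
  geom n - (1 + alpha) * geom n.-1 + alpha * geom n.-2 = (n == 1)%:R.
Proof.
by case: n => [|[|n]] /=; rewrite ?geomS ?geom0; ring.
Qed.

Definition infG : infmx R := ltoeplitz (fun n => geom n.+1).

(** Above the diagonal the truncated subtraction gives [geom 0 = 0], so one formula serves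
    everywhere. *)
Lemma infGE (i j : nat) : infG i j = geom (i.+1 - j).
Proof.
rewrite /infG /ltoeplitz; case: leqP => [ji|ij]; first by rewrite subSn.
by rewrite (eqP ij) geom0.
Qed.

Lemma mul_infF2_infG : inf_mul (infF2 alpha) infG = infmx1 R.
Proof.
apply/funext => i; apply/funext => j.
rewrite (@inf_mul_finite _ _ _ _ i.+1); last first.
  by move=> k ik; rewrite infF2E !ltn_eqF ?mulr0 ?subrr ?addr0 ?mul0r //; lia.
rewrite (sum_infF2_row _ _ (infG^~ j)) // !infGE /infmx1.
rewrite (_ : (i == j) = (i.+1 - j == 1)%N); last by lia.
(* In rows 0 and 1 part of the band is missing; the matching terms of [geom_rec] are
   [geom 0 = 0]. *)
rewrite -geom_rec; case: i => [|[|i]] /=.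
- by case: j => [|j]; rewrite ?subn0 /= ?subSS ?sub0n /= geom0; ring.
- by case: j => [|[|j]]; rewrite ?subn0 /= ?subSS ?sub0n /= geom0; ring.
- have -> : (i.+2 - j = (i.+3 - j).-1)%N by lia.
  have -> : (i.+1 - j = (i.+3 - j).-2)%N by lia.
  by rewrite !mulr1.
Qed.

Lemma mul_infG_infF2 : inf_mul infG (infF2 alpha) = infmx1 R.
Proof.
apply/funext => i; apply/funext => j.
(* The cut lies past the support of row [i] of [infG] and past the three band entries of column
   [j]. *)
rewrite (@inf_mul_finite _ _ _ _ (i + j).+3); last first.
  by move=> k ik; rewrite infGE (_ : _ - k = 0)%N ?geom0 ?mul0r //; lia.
under eq_bigr do rewrite mulrC.
rewrite (sum_infF2_col _ _ (infG i)) // !infGE /infmx1.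
rewrite (_ : (i == j) = (i.+1 - j == 1)%N) -?geom_rec; last by lia.
have -> : (j < (i + j).+3)%N by lia.
have -> : (j.+1 < (i + j).+3)%N by lia.
have -> : (j.+2 < (i + j).+3)%N by lia.
have -> : (i.+1 - j.+1 = (i.+1 - j).-1)%N by lia.
have -> : (i.+1 - j.+2 = (i.+1 - j).-2)%N by lia.
by rewrite mul1r !mulr1.
Qed.

(** [xget] returns an unspecified inverse, so uniqueness is needed: column 0 of the product is a
    second-order recurrence that determines every coefficient. *)
Lemma ltoeplitz_inv_infF2 : ltoeplitz_inv (infF2 alpha) = infG.
Proof.
apply: xget_unique.
  split; last by split; [exact: mul_infF2_infG|exact: mul_infG_infF2].
  by exists (fun n => geom n.+1).
move=> _ [[c ->] [F2c _]]; congr ltoeplitz; apply/funext => n.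
have c_rec m : c m - (1 + alpha) * (0 < m)%:R * c m.-1
    + alpha * (1 < m)%:R * c m.-2 = (m == 0)%:R.
  have := congr1 (fun A : infmx R => A m 0) F2c.
  rewrite (@inf_mul_finite _ _ _ _ m.+1); last first.
    by move=> k ik; rewrite infF2E !ltn_eqF ?mulr0 ?subrr ?addr0 ?mul0r //; lia.
  by rewrite (sum_infF2_row _ _ ((ltoeplitz c)^~ 0)) //
    /ltoeplitz !leq0n !subn0.
suff : c n = geom n.+1 /\ c n.+1 = geom n.+2 by case.
elim: n => [|n [cn cn1]].
  have c0 : c 0 = 1 by have := c_rec 0; rewrite /=; lra.
  by have := c_rec 1; rewrite /= !geomS geom0 c0; split; lra.
split=> //; have := c_rec n.+2; rewrite /= cn cn1 => c_rec2.
by have := geom_rec n.+3; rewrite /=; lra.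
Qed.

(** * Convergence and summation of the kernel series *)

Lemma geom_ge0 n : 0 <= alpha -> 0 <= geom n.
Proof. by move=> a0; apply: sumr_ge0 => k _; exact: exprn_ge0. Qed.

(** With [y_n = r^n geom n] one has [y_(n+1) <= r (1 + y_n)], and [r (1 + 1/(1 - r)) = (1 - (1 -
    r)^2)/(1 - r)] stays below the bound. *)
Lemma geom_exp_bound (r : R) n : 0 <= alpha <= 1 -> 0 < r < 1 ->
  r ^+ n * geom n <= (1 - r)^-1.
Proof.
move=> /andP[a0 a1] /andP[r0 r1].
have r1_gt0 : 0 < 1 - r by rewrite subr_gt0.
elim: n => [|n IH]; first by rewrite geom0 mulr0 invr_ge0 ltW.
set y := r ^+ n * geom n in IH *.
have -> : r ^+ n.+1 * geom n.+1 = r * (r ^+ n + alpha * y).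
  by rewrite /y geomS exprS; ring.
have rn1 : r ^+ n <= 1 by rewrite exprn_ile1 // ltW.
have y0 : 0 <= y by rewrite mulr_ge0 ?exprn_ge0 ?geom_ge0 // ltW.
have ay : alpha * y <= y by rewrite ler_piMl.
rewrite -[_^-1]mul1r !ler_pdivlMr // in IH *.
(* The slack is a sum of nonnegative terms coming from a square, [r^n <= 1], [alpha y <= y] and the
   induction hypothesis. *)
have -> : r * (r ^+ n + alpha * y) * (1 - r)
    = 1 - (1 - r) ^+ 2 - r * (1 - r) * (1 - r ^+ n)
      - r * (1 - r) * (y - alpha * y) - r * (1 - y * (1 - r)) by ring.
have : 0 <= (1 - r) ^+ 2 by apply: exprn_ge0; apply: ltW.
have : 0 <= r * (1 - r) * (1 - r ^+ n) by rewrite !mulr_ge0 ?subr_ge0 // ltW.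
have : 0 <= r * (1 - r) * (y - alpha * y) by rewrite !mulr_ge0 ?subr_ge0 // ltW.
have : 0 <= r * (1 - y * (1 - r)) by rewrite !mulr_ge0 ?subr_ge0 // ltW.
lra.
Qed.

Variable beta : R.
Hypotheses (alpha01 : 0 <= alpha <= 1) (beta01 : 0 < beta < 1).

(* With [beta = r^4], the sequence is [(r^n)^2 (r^n geom n)^2], and the second
   factor is bounded. *)
Lemma cvg_exp_geom_sqr : (fun n => beta ^+ n * geom n ^+ 2) @ \oo --> 0.
Proof.
have /andP[a0 a1] := alpha01; have /andP[b0 b1] := beta01.
pose q := Num.sqrt beta; pose r := Num.sqrt q.
have q0 : 0 < q by rewrite sqrtr_gt0.
have r0 : 0 < r by rewrite sqrtr_gt0.
have qq : q ^+ 2 = beta by rewrite sqr_sqrtr // ltW.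
have rr : r ^+ 2 = q by rewrite sqr_sqrtr // ltW.
have q1 : q < 1 by rewrite -(@expr_lt1 _ 2) ?qq // ltW.
have r1 : r < 1 by rewrite -(@expr_lt1 _ 2) ?rr // ltW.
have bE n : beta ^+ n * geom n ^+ 2 = q ^+ n * (r ^+ n * geom n) ^+ 2.
  by rewrite exprMn -[r ^+ n ^+ 2]exprAC rr [RHS]mulrA -exprMn -expr2 qq.
have cvg_bound : (fun n => q ^+ n * ((1 - r)^-1) ^+ 2) @ \oo --> 0.
  rewrite -[0](mul0r ((1 - r)^-1 ^+ 2)); apply: cvgM; last exact: cvg_cst.
  by apply: cvg_expr; rewrite ger0_norm // ltW.
apply: (@squeeze_cvgr _ _ _ _ (fun=> 0) _ _ _ _ _ cvg_bound);
  last exact: cvg_cst.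
near=> n; rewrite bE.
have y0 : 0 <= r ^+ n * geom n.
  by rewrite mulr_ge0 ?geom_ge0 // exprn_ge0 ?ltW.
have qn0 : 0 <= q ^+ n by rewrite exprn_ge0 // ltW.
rewrite mulr_ge0 // ?[0 <= _ ^+ 2]exprn_ge0 //= ler_wpM2l //.
by rewrite lerXn2r ?nnegrE ?geom_exp_bound ?r0 // (le_trans y0) //
  geom_exp_bound ?r0.
Unshelve. all: by end_near. Qed.

(** This is [kappa] times the sum over [k] of [beta^k geom(k+1) geom(k+1+d)], in a form that makes
    sense at [alpha = 1]. *)
Definition phi d : R :=
  (1 - alpha ^+ 2 * beta) * geom d + (1 + alpha * beta) * alpha ^+ d.

(* [tail d n / kappa] is the tail from [n] on of the series with terms
   [beta^k geom(k+1) geom(k+1+d)]. Since [geom(n+2) = 1 + alpha geom(n+1)], such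
   a tail is [beta^n] times a quadratic polynomial in [geom(n+1)], whose
   coefficients are determined by [tail_telescope]. *)
Definition tail d n : R :=
  beta ^+ n * (beta * phi d
    + (1 - beta) * ((1 - alpha ^+ 2 * beta) * geom d
                    + 2 * alpha * beta * alpha ^+ d) * geom n.+1
    + (1 - beta) * (1 - alpha * beta) * alpha ^+ d * geom n.+1 ^+ 2).

Lemma tail0 d : tail d 0 = phi d.
Proof. by rewrite /tail geomS geom0 /phi; ring. Qed.

Lemma tail_telescope d n : tail d n - tail d n.+1 =
  kappa alpha beta * (beta ^+ n * geom n.+1 * geom (n.+1 + d)).
Proof.
(* Splitting [geom (d + n.+1)] leaves a polynomial identity in [geom n.+1], [geom d] and
   [alpha^d]. *)
rewrite addnC geomD /tail /kappa [geom n.+2]geomS [beta ^+ n.+1]exprS /phi.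
ring.
Qed.

Lemma kappa_factors_gt0 :
  [/\ 0 < 1 - beta, 0 < 1 - alpha * beta & 0 < 1 - alpha ^+ 2 * beta].
Proof.
have /andP[a0 a1] := alpha01; have /andP[b0 b1] := beta01.
have ab1 : alpha * beta < 1 by rewrite (le_lt_trans _ b1) // ler_piMl // ltW.
have aab1 : alpha ^+ 2 * beta < 1.
  by rewrite (le_lt_trans _ ab1) // expr2 ler_wpM2r // ?ler_piMl // ltW.
by rewrite !subr_gt0.
Qed.

Lemma kappa_gt0 : 0 < kappa alpha beta.
Proof.
have [b1 ab1 aab1] := kappa_factors_gt0; by rewrite /kappa !mulr_gt0.
Qed.

(** The polynomial in [tail] has nonnegative coefficients and [geom n.+1 >= 1], so it is at most its
    coefficient sum times [geom n.+1 ^+ 2]; squeezing applies. *)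
Lemma cvg_tail d : tail d @ \oo --> 0.
Proof.
have /andP[a0 a1] := alpha01; have /andP[b0 b1] := beta01.
have sqr_cvg : (fun n => beta ^+ n * geom n.+1 ^+ 2) @ \oo --> 0.
  have -> : (fun n => beta ^+ n * geom n.+1 ^+ 2)
     = (fun n => beta^-1 * (beta ^+ (n + 1) * geom (n + 1) ^+ 2)).
    by apply/funext => n; rewrite addn1 [beta ^+ n.+1]exprS -mulrA mulKf //
      gt_eqF.
  rewrite -[0](mulr0 beta^-1); apply: cvgM; first exact: cvg_cst.
  by have := cvg_exp_geom_sqr; rewrite -(cvg_shiftn 1).
set c1 := (1 - beta) * ((1 - alpha ^+ 2 * beta) * geom d
                    + 2 * alpha * beta * alpha ^+ d).
set c2 := (1 - beta) * (1 - alpha * beta) * alpha ^+ d.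
have [/ltW b1' /ltW ab1' /ltW aab1'] := kappa_factors_gt0.
have b0' := ltW b0.
have ad0 : 0 <= alpha ^+ d by rewrite exprn_ge0.
have gd0 := geom_ge0 d a0.
have bphi0 : 0 <= beta * phi d.
  by rewrite /phi mulr_ge0 // addr_ge0 // mulr_ge0 // addr_ge0 // mulr_ge0.
have c10 : 0 <= c1.
  by rewrite /c1 mulr_ge0 // addr_ge0 // mulr_ge0 // !mulr_ge0.
have c20 : 0 <= c2 by rewrite /c2 !mulr_ge0.
have cvg_bound :
    (fun n => (beta * phi d + c1 + c2) * (beta ^+ n * geom n.+1 ^+ 2)) @ \oo
      --> 0.
  rewrite -[0](mulr0 (beta * phi d + c1 + c2)).
  by apply: cvgM; first exact: cvg_cst.
apply: (@squeeze_cvgr _ _ _ _ (fun=> 0) _ _ _ _ _ cvg_bound);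
  last exact: cvg_cst.
near=> n; rewrite /tail -/c1 -/c2.
have x1 : 1 <= geom n.+1 by rewrite geomS lerDl mulr_ge0 ?geom_ge0.
have x0 : 0 <= geom n.+1 by rewrite geom_ge0.
have xx : geom n.+1 <= geom n.+1 ^+ 2 by rewrite expr2 ler_peMl.
apply/andP; split.
  rewrite mulr_ge0 ?[0 <= beta ^+ n]exprn_ge0 // addr_ge0 //.
    by rewrite addr_ge0 // mulr_ge0.
  by rewrite mulr_ge0 // exprn_ge0.
rewrite [leRHS]mulrCA ler_wpM2l ?[0 <= beta ^+ n]exprn_ge0 //.
rewrite !mulrDl !lerD // ?ler_wpM2l //.
by rewrite ler_peMr // (le_trans x1).
Unshelve. all: by end_near. Qed.

(** The diagonal factor reduces the inner series to one term, leaving a single series over [k]. *)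
Lemma infK_series i j : infK_DC2 alpha beta i j = kappa alpha beta *
  limn (series (fun k => beta ^+ k.+1 * geom (k.+1 - i) * geom (k.+1 - j))).
Proof.
rewrite /infK_DC2 ltoeplitz_inv_infF2; congr (_ * _).
rewrite {1}/inf_mul; congr (limn (series _)).
apply/funext => k; rewrite (@inf_mul_finite _ _ _ _ k.+1); last first.
  by move=> l kl; rewrite /inf_diag gtn_eqF ?mulr0.
rewrite (bigD1 ord_max) //= big1 ?addr0; last first.
  by move=> l; rewrite -val_eqE /= /inf_diag => /negbTE ->; rewrite mulr0.
by rewrite /inf_diag eqxx /diagD invrK /inf_tr !infGE [beta ^+ _ * _]mulrC.
Qed.

Lemma infK_sym i j : infK_DC2 alpha beta i j = infK_DC2 alpha beta j i.
Proof.
by rewrite !infK_series; under eq_fun do rewrite mulrAC.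
Qed.

(** The first [i + d] terms vanish because [geom 0 = 0]; after a shift by that many, the partial
    sums telescope and the remaining tail tends to 0. *)
Lemma infKE i d : infK_DC2 alpha beta i (i + d)%N = beta ^+ (i + d).+1 * phi d.
Proof.
have k0 : kappa alpha beta != 0 by rewrite gt_eqF // kappa_gt0.
rewrite infK_series; set u := (fun k => _).
have partial_sum n : series u (n + (i + d))%N =
    (kappa alpha beta)^-1 * (beta ^+ (i + d).+1 * (tail d 0 - tail d n)).
  elim: n => [|n IH].
    rewrite subrr !mulr0 /series/= big_nat_cond big1 // => k.
    rewrite andbT => /andP[_ kid].
    by rewrite /u (_ : k.+1 - (i + d) = 0)%N ?geom0 ?mulr0 //; lia.
  rewrite addSn seriesSr IH /u.
  have -> : ((n + (i + d)).+1 - i = n.+1 + d)%N by lia.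
  have -> : ((n + (i + d)).+1 - (i + d) = n.+1)%N by lia.
  apply: (mulfI k0); rewrite mulrDr !mulVKf //.
  have -> : (n + (i + d)).+1 = ((i + d).+1 + n)%N by lia.
  by have := tail_telescope d n; rewrite exprD; nra.
suff -> : limn (series u) = (kappa alpha beta)^-1
    * (beta ^+ (i + d).+1 * (phi d - 0)) by rewrite subr0 mulVKf.
apply: cvg_lim; first exact: Rhausdorff.
rewrite -(cvg_shiftn (i + d)); under eq_fun do rewrite partial_sum tail0.
do 2 (apply: cvgM; first exact: cvg_cst).
by apply: cvgB; [exact: cvg_cst|exact: cvg_tail].
Qed.

(** * Recurrences for [phi] and the truncated product [F2^T K F2] *)

Lemma phi0 : phi 0 = 1 + alpha * beta.
Proof. by rewrite /phi geom0; ring. Qed.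

Lemma phi1 : phi 1 = 1 + alpha.
Proof. by rewrite /phi geomS geom0; ring. Qed.

(** Both summands of [phi] obey the recurrence with characteristic roots 1 and [alpha]. *)
Lemma phiSS d : phi d.+2 = (1 + alpha) * phi d.+1 - alpha * phi d.
Proof. by rewrite /phi !geomS !exprS geom_exp; ring. Qed.

Lemma phi_rec d : phi d - (1 + alpha) * beta * phi d.+1
    + alpha * beta ^+ 2 * phi d.+2 = kappa alpha beta * geom d.+1.
Proof.
by rewrite /phi /kappa !geomS ![alpha ^+ _.+1]exprS [alpha ^+ d]geom_exp; ring.
Qed.

(** This is [K F2 = kappa G^T D^-1] in the columns whose three band entries all fit inside the
    truncation. *)
Lemma infK_infF2 i j N : (j.+2 < N)%N ->
  \sum_(k < N) infF2 alpha k j * infK_DC2 alpha beta i k =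
  kappa alpha beta * beta ^+ j.+1 * geom (j.+1 - i).
Proof.
move=> jN; rewrite (sum_infF2_col _ _ (infK_DC2 alpha beta i)) jN.
rewrite (ltnW jN) (ltnW (ltnW jN)) mul1r !mulr1.
have [ij|] := leqP i j.
  rewrite -(subnKC ij); set d := (j - i)%N.
  rewrite -!addnS !infKE !addnS subSn ?leq_addr // addKn.
  by rewrite [RHS]mulrAC -phi_rec !exprS; ring.
(* At [i = j + 1] the three entries straddle the diagonal and cancel through the values [phi 0] and
   [phi 1]. *)
rewrite leq_eqVlt => /predU1P[<-|ji].
  have := infKE j 1; have := infKE j.+1 0; have := infKE j.+1 1.
  rewrite !addn0 !addn1 phi0 phi1 [infK_DC2 _ _ j.+1 j]infK_sym => -> -> ->.
  by rewrite subnn geom0 !exprS; ring.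
rewrite [X in _ * geom X](_ : _ = 0)%N ?geom0 ?mulr0; last by lia.
(* By symmetry the three entries share the factor [beta^(i + 1)], so [phiSS] cancels them. *)
rewrite ![infK_DC2 _ _ i _]infK_sym -(subnKC ji); set d := (i - j.+2)%N.
have := infKE j d.+2; have := infKE j.+1 d.+1; have := infKE j.+2 d.
rewrite !addSn !addnS => -> -> ->; rewrite phiSS; ring.
Qed.

Definition congruence N i j : R := \sum_(t < N) infF2 alpha t i *
  \sum_(s < N) infF2 alpha s j * infK_DC2 alpha beta t s.

Lemma congruence_sym N i j : congruence N i j = congruence N j i.
Proof.
rewrite /congruence; under eq_bigr do rewrite mulr_sumr.
rewrite exchange_big; apply: eq_bigr => s _; rewrite mulr_sumr.
by apply: eq_bigr => t _; rewrite mulrCA infK_sym.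
Qed.

Lemma congruence_diag N i j : (i < N)%N -> (j.+2 < N)%N ->
  congruence N i j = (i == j)%:R * (kappa alpha beta * beta ^+ j.+1).
Proof.
move=> iN jN; rewrite /congruence.
under eq_bigr do rewrite infK_infF2 //.
rewrite (sum_infF2_col _ _ (fun t => _ * geom (j.+1 - t))) iN mul1r.
rewrite (_ : (i == j) = (j.+1 - i == 1)%N) -?geom_rec; last by lia.
rewrite -(_ : j.+1 - i.+2 = (j.+1 - i).-2)%N; last by lia.
rewrite -(_ : j.+1 - i.+1 = (j.+1 - i).-1)%N; last by lia.
(* Rows [k >= N] lie beyond [j + 1], where [geom] is 0, so truncating the outer sum loses nothing
   even when [i] is one of the last two indices. *)
have trunc k : (k < N)%N%:R * geom (j.+1 - k) = geom (j.+1 - k).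
  case: ltnP => kN; first by rewrite mul1r.
  by rewrite (_ : j.+1 - k = 0)%N ?geom0 ?mulr0 //; lia.
by rewrite -[in RHS](trunc i.+1) -[in RHS](trunc i.+2); ring.
Qed.

(** Truncation cuts column [n] of [F2] to [1, -(1 + alpha)] and column [n.+1] to [1], so only the
    lower right 2 x 2 block of the kernel enters. *)
Lemma congruence_corner n :
  [/\ congruence n.+2 n n = beta ^+ n.+1 *
        ((1 + alpha * beta) - beta * (1 + alpha) ^+ 2 * (1 - alpha * beta)),
      congruence n.+2 n n.+1 = - (beta ^+ n.+2 * (alpha * beta * (1 + alpha)))
    & congruence n.+2 n.+1 n.+1 = beta ^+ n.+2 * (1 + alpha * beta)].
Proof.
have Knn : infK_DC2 alpha beta n n = beta ^+ n.+1 * (1 + alpha * beta).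
  by have := infKE n 0; rewrite addn0 phi0.
have KSS : infK_DC2 alpha beta n.+1 n.+1 = beta ^+ n.+2 * (1 + alpha * beta).
  by have := infKE n.+1 0; rewrite addn0 phi0.
have KnS : infK_DC2 alpha beta n n.+1 = beta ^+ n.+2 * (1 + alpha).
  by have := infKE n 1; rewrite addn1 phi1.
have KSn := KnS; rewrite infK_sym in KSn.
have lt0 : (n < n.+2)%N%:R = 1 :> R by rewrite ltnS leqnSn.
have lt1 : (n.+1 < n.+2)%N%:R = 1 :> R by rewrite ltnSn.
have lt2 : (n.+2 < n.+2)%N%:R = 0 :> R by rewrite ltnn.
have lt3 : (n.+3 < n.+2)%N%:R = 0 :> R by rewrite ltnNge leqnSn.
have in1 t : \sum_(s < n.+2) infF2 alpha s n * infK_DC2 alpha beta t s =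
    infK_DC2 alpha beta t n - (1 + alpha) * infK_DC2 alpha beta t n.+1.
  by rewrite (sum_infF2_col _ _ (infK_DC2 alpha beta t)) lt0 lt1 lt2; ring.
have in2 t : \sum_(s < n.+2) infF2 alpha s n.+1 * infK_DC2 alpha beta t s =
    infK_DC2 alpha beta t n.+1.
  by rewrite (sum_infF2_col _ _ (infK_DC2 alpha beta t)) lt1 lt2 lt3; ring.
have out1 x : \sum_(s < n.+2) infF2 alpha s n * x s =
    x n - (1 + alpha) * x n.+1.
  by rewrite sum_infF2_col lt0 lt1 lt2; ring.
have out2 x : \sum_(s < n.+2) infF2 alpha s n.+1 * x s = x n.+1.
  by rewrite sum_infF2_col lt1 lt2 lt3; ring.
split; rewrite /congruence.
- under eq_bigr do rewrite in1.
  rewrite (out1 (fun t => infK_DC2 alpha beta t n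
    - (1 + alpha) * infK_DC2 alpha beta t n.+1)).
  by rewrite Knn KnS KSn KSS !exprS; ring.
- under eq_bigr do rewrite in2.
  by rewrite (out1 (infK_DC2 alpha beta ^~ n.+1)) KnS KSS !exprS; ring.
- under eq_bigr do rewrite in2.
  by rewrite (out2 (infK_DC2 alpha beta ^~ n.+1)) KSS.
Qed.
End Entries.

(** * Assembly of the finite matrices and inversion *)

Lemma D_E (R : realType) (alpha beta : R) T (hT : (2 <= T)%N) (i j : 'I_T) :
  D_ alpha beta hT i j =
  if (i < T - 2)%N || (j < T - 2)%N then (i == j)%:R * beta ^- i.+1
  else B_ alpha beta T (inord (i - (T - 2))) (inord (j - (T - 2))).
Proof.
rewrite /D_ castmxE.
(* An index in the lower block has offset below 2, so [inord] returns that offset and not its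
   default. *)
have shift (k : 'I_T) (l : 'I_2) : nat_of_ord k = (T - 2 + l)%N ->
    inord (k - (T - 2)) = l.
  by move=> ->; rewrite addKn inord_val.
rewrite mxE; case: splitP => k /= ik; rewrite mxE; case: splitP => l /= jl.
- rewrite -[i == j]val_eqE /= ik jl !ltn_ord !mxE val_eqE.
  by case: eqP => [->|_]; rewrite ?mulr1n ?mul1r ?mulr0n ?mul0r.
- by rewrite -[i == j]val_eqE /= ik jl ltn_ord mxE ltn_eqF ?mul0r // ltn_addr.
- by rewrite -[i == j]val_eqE /= ik jl ltn_ord orbT mxE gtn_eqF
    ?mul0r // ltn_addr.
- by rewrite (shift i k ik) (shift j l jl) ik jl !ltnNge !leq_addr.
Qed.

Lemma congruence_D (R : realType) (alpha beta : R) T (hT : (2 <= T)%N) :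
  0 <= alpha <= 1 -> 0 < beta < 1 ->
  (\matrix_(i, j) congruence alpha beta T i j) *m D_ alpha beta hT
  = (kappa alpha beta)%:M.
Proof.
move=> alpha01 beta01; have /andP[b0 _] := beta01.
have bX n : beta ^+ n != 0 by rewrite expf_neq0 // gt_eqF.
have bb : beta != 0 by rewrite gt_eqF.
apply/matrixP => i j; rewrite !mxE -mulr_natr.
(* A column [j < T - 2] of [D_] has only its diagonal entry, which [congruence_diag] inverts up to
   [kappa]. *)
have [jT|Tj] := ltnP j (T - 2).
  under eq_bigr => k _.
    rewrite mxE D_E jT orbT mulrC -mulrA -val_eqE.
    over.
  rewrite (sum_delta _ _ (fun k => beta ^- k.+1 * congruence alpha beta T i k)).
  rewrite ltn_ord mul1r (congruence_diag _ _ alpha01 beta01) //;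
    last by rewrite /=; lia.
  by rewrite mulrCA [kappa _ _ * _]mulrC mulKf // mulrC.
(* In the last two columns of [D_], with [T = n.+2], only the last two summands survive. *)
case: T hT i j Tj => [//|[//|n]] hT i j; rewrite subn2 /= => nj.
rewrite !big_ord_recr /= big1 ?add0r; last first.
  move=> k _; rewrite !mxE D_E subn2 /= ltn_ord -val_eqE /= ltn_eqF
    ?mul0r ?mulr0 //.
  by rewrite (leq_trans _ nj).
have ltSn : (n.+1 < n)%N = false by lia.
have ltjn : (j < n)%N = false by lia.
rewrite !mxE !D_E subn2 /= ltnn ltSn ltjn /= subnn subSnn -val_eqE /=.
have [e1 e2 e3] := congruence_corner _ _ alpha01 beta01 n.
have e2' := e2; rewrite congruence_sym in e2'.
(* For [i < n], symmetry moves the interior index to the second slot, where [congruence_diag] gives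
   0. *)
have [ij0|ni] := ltnP i n.
  rewrite ![congruence _ _ _ i _]congruence_sym
    !(congruence_diag _ _ alpha01 beta01) //.
  rewrite (gtn_eqF ij0) (gtn_eqF (leqW ij0)) (ltn_eqF (leq_trans ij0 nj)).
  by rewrite !mul0r addr0 mulr0.
have in0 : (inord 0 : 'I_2) = 0 by apply/val_inj; rewrite /= inordK.
have in1 : (inord 1 : 'I_2) = 1 by apply/val_inj; rewrite /= inordK.
have ord_cases (k : 'I_n.+2) : (n <= k)%N -> k = n :> nat \/ k = n.+1 :> nat.
  by have := ltn_ord k; lia.
have [[i0|i1] [j0|j1]] := (ord_cases i ni, ord_cases j nj).
(* The four corner cases check that the 2 x 2 block of [congruence_corner] times [B_] is [kappa]
   times the identity. *)
- rewrite i0 j0 subnn !in0 in1 e1 e2 !mxE /= ?eqxx ?[n == n.+1]ltn_eqF //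
    ?[n.+1 == n]gtn_eqF // ?mulr1 ?mulr0 /kappa ![beta ^+ _.+1]exprS.
  by field; rewrite bb bX.
- rewrite i0 j1 subSnn in0 in1 e1 e2 !mxE /= ?eqxx ?[n == n.+1]ltn_eqF //
    ?[n.+1 == n]gtn_eqF // ?mulr1 ?mulr0 /kappa ![beta ^+ _.+1]exprS.
  by field; rewrite bb bX.
- rewrite i1 j0 subnn in0 in1 e2' e3 !mxE /= ?eqxx ?[n == n.+1]ltn_eqF //
    ?[n.+1 == n]gtn_eqF // ?mulr1 ?mulr0 /kappa ![beta ^+ _.+1]exprS.
  by field; rewrite bb bX.
- rewrite i1 j1 subSnn in0 in1 e2' e3 !mxE /= ?eqxx ?[n == n.+1]ltn_eqF //
    ?[n.+1 == n]gtn_eqF // ?mulr1 ?mulr0 /kappa ![beta ^+ _.+1]exprS.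
  by field; rewrite bb bX.
Qed.

Lemma congruenceE (R : realType) (alpha beta : R) T :
  (\matrix_(i < T, j < T) congruence alpha beta T i j) =
  (F2_ alpha T)^T *m (K_DC2 alpha beta T *m F2_ alpha T).
Proof.
apply/matrixP => i j; rewrite !mxE; apply: eq_bigr => t _.
rewrite [_^T _ _]mxE F2_E mxE; congr (_ * _); apply: eq_bigr => l _.
by rewrite F2_E mxE mulrC.
Qed.

(** Adding bandwidths would only give 3. But an off-diagonal entry [(k, l)] of [D_] has
    [k, l >= T - 2], which forces [t, s >= T - 2]; otherwise [k = l] and both [t] and [s] lie in
    [[k, k + 2]]. *)
Lemma pentadiagonal_F2_D_F2 (R : realType) (alpha beta : R) T
    (hT : (2 <= T)%N) :
  pentadiagonal (F2_ alpha T *m D_ alpha beta hT *m (F2_ alpha T)^T).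
Proof.
have F20 (i j : 'I_T) : (i < j)%N || (j.+2 < i)%N -> F2_ alpha T i j = 0.
  move=> ij; rewrite F2_E infF2E.
  have -> : (i == j :> nat) = false by lia.
  have -> : (i == j.+1 :> nat) = false by lia.
  have -> : (i == j.+2 :> nat) = false by lia.
  by rewrite !mulr0 subr0 addr0.
have D0 (i j : 'I_T) : i != j -> (i < T - 2)%N || (j < T - 2)%N ->
    D_ alpha beta hT i j = 0.
  by move=> /negbTE ij ijT; rewrite D_E ijT ij mul0r.
move=> t s ts; rewrite mxE big1 // => l _.
rewrite mxE mulr_suml big1 // => k _; rewrite [_^T _ _]mxE.
have tT := ltn_ord t; have sT := ltn_ord s.
have [tk|] := boolP ((t < k)%N || (k.+2 < t)%N); first by rewrite F20 // !mul0r.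
have [sl|] := boolP ((s < l)%N || (l.+2 < s)%N).
  by rewrite (F20 s) // mulr0.
by move=> sl tk; rewrite D0 ?mulr0 ?mul0r // -?val_eqE /=; lia.
Qed.

Theorem proposition6p2 (R : realType) (alpha beta : R)
  (hbeta : 0 < beta < 1) (halpha : 0 <= alpha <= 1)
  (T : nat) (hT : (2 <= T)%N) :
  K_DC2 alpha beta T \in unitmx /\
  invmx (K_DC2 alpha beta T) =
    (kappa alpha beta)^-1 *:
      (F2_ alpha T *m D_ alpha beta hT *m (F2_ alpha T)^T) /\
  pentadiagonal (invmx (K_DC2 alpha beta T)).
Proof.
have k0 : kappa alpha beta != 0 by rewrite gt_eqF // kappa_gt0.
set K := K_DC2 alpha beta T; set F := F2_ alpha T; set D := D_ alpha beta hT.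
(* This exhibits a right inverse of [F^T]. For square matrices it is also a left inverse, so
   [mulmx1C] moves [F^T] to the far right and yields a right inverse of [K]. *)
have FKFD : F^T *m ((kappa alpha beta)^-1 *: (K *m F *m D)) = 1%:M.
  rewrite -scalemxAr mulmxA -congruenceE congruence_D //.
  by rewrite scale_scalar_mx mulVf.
have KX : K *m ((kappa alpha beta)^-1 *: (F *m D *m F^T)) = 1%:M.
  by rewrite -(mulmx1C FKFD) -scalemxAr -scalemxAl !mulmxA.
have Kunit : K \in unitmx by case: (mulmx1_unit KX).
have KV : invmx K = (kappa alpha beta)^-1 *: (F *m D *m F^T).
  by rewrite -[RHS](mulKmx Kunit) KX mulmx1.
split=> //; split=> //; rewrite KV => t s ts.
by rewrite mxE pentadiagonal_F2_D_F2 ?mulr0.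
Qed.
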